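(* Let $\mathcal{Q}$ be the set of square-free natural numbers (the positive integers with no square factor other than $1$, i.e. those $m$ with $\mu^2(m)=1$, where $\mu$ is the Möbius function), and let $a(0)<a(1)<a(2)<\cdots$ be all the elements of $\mathcal{Q}$. Then the dual entropy of $(a(n))_{n\in\mathbb{N}}$ is infinite: $\mathrm{AE}^*\big((a(n))_{n\in\mathbb{N}}\big)=\infty$.
   Context: $\mathbb{N}=\{0,1,2,\dots\}$. Entropy of a sequence: let $x=(x(n))_{n\in\mathbb{N}}$ be a sequence in $K=\mathbb{R}/\mathbb{Z}$, or a bounded sequence in $K=\mathbb{C}$. Let $X_0$ be the closure of $\{x(n):n\in\mathbb{N}\}$ in $K$ (a compact space), and let $X_x$ be the closure of $\{(x(m),x(m+1),x(m+2),\dots): m\in\mathbb{N}\}$ in $X_0^{\mathbb{N}}$ with the product topology. The shift $\sigma:(\omega_0,\omega_1,\dots)\mapsto(\omega_1,\omega_2,\dots)$ maps $X_x$ continuously to itself. The (anqie) entropy of $x$, denoted $\mathrm{AE}(x)\in[0,\infty]$, is the topological entropy of $(X_x,\sigma)$: the supremum over open covers $\mathcal{U}$ of $X_x$ of $\lim_{n}\frac1n\log\mathcal{N}(\mathcal{U}\vee\sigma^{-1}\mathcal{U}\vee\cdots\vee\sigma^{-n+1}\mathcal{U})$, where $\mathcal{N}(\mathcal{W})$ is the minimal cardinality of a subcover of $\mathcal{W}$. Dual entropy: let $(a(n))_{n\in\mathbb{N}}$ be a sequence of integers and, for real $x$, let $a_x(n):=a(n)x\bmod 1\in\mathbb{R}/\mathbb{Z}$.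 If there is $\lambda\in[0,\infty]$ such that $\mathrm{AE}(a_x)=\lambda$ for Lebesgue-almost all real $x$, then $(a(n))$ is called centered and $\lambda$ is its dual entropy, written $\mathrm{AE}^*((a(n))_{n\in\mathbb{N}})=\lambda$. *)

(* Defs.v *)
From HB Require Import structures.
From mathcomp Require Import all_boot all_order all_algebra generic_quotient.
From mathcomp Require Import all_classical all_reals all_analysis.

Set Implicit Arguments.
Unset Strict Implicit.
Unset Printing Implicit Defensive.

Import Order.TTheory GRing.Theory Num.Theory.
Import numFieldNormedType.Exports.
Local Open Scope classical_set_scope.
Local Open Scope ring_scope.

Section RmodZ.
Variable R : realType.

Definition modZ : rel R := [rel x y | x - y \is a Num.int].

Lemma modZ_refl : reflexive modZ.
Proof. by move=> x; rewrite /modZ /= subrr rpred0. Qed.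

Lemma modZ_sym : symmetric modZ.
Proof. by move=> x y; rewrite /modZ /= -rpredN opprB. Qed.

Lemma modZ_trans : transitive modZ.
Proof.
by move=> y x z; rewrite /modZ /= => xy yz; rewrite -(subrKA y) rpredD.
Qed.

Canonical modZ_equiv := EquivRel modZ modZ_refl modZ_sym modZ_trans.

Definition RmodZ : topologicalType :=
  quotient_topology {eq_quot modZ_equiv}%qT.

Definition mod1 (x : R) : RmodZ := \pi_({eq_quot modZ_equiv})%qT x.

End RmodZ.

Section topological_entropy.
Variables (R : realType) (X : topologicalType).
Implicit Types (U V W : set (set X)) (T : X -> X).

Definition covers U : Prop := \bigcup_(u in U) u = setT.

Definition open_cover U : Prop := U `<=` open /\ covers U.

Definition cover_join U V : set (set X) := [set u `&` v | u in U & v in V].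

Definition preimage_cover T U : set (set X) := [set T @^-1` u | u in U].

(* [set setT] is neutral for cover_join *)
Definition iterated_join T U (n : nat) : set (set X) :=
  \big[cover_join/[set setT]]_(i < n) preimage_cover (iter i T) U.

(* The infimum over finite subcovers; it is +oo when there are none, which
   does not happen for an open cover of a compact space. *)
Definition min_subcover W : \bar R :=
  ereal_inf [set n%:R%:E | n in
    [set n : nat | exists V, [/\ V `<=` W, (V #= `I_n)%card & covers V]]].

Definition cover_entropy T U : \bar R :=
  limn (fun n => (n%:R^-1)%:E * lne (min_subcover (iterated_join T U n)))%E.

Definition topological_entropy T : \bar R :=
  ereal_sup [set cover_entropy T U | U in open_cover].

End topological_entropy.

Section anqie_entropy.
Variables (R : realType) (K : topologicalType) (x : nat -> K).

Definition X0 : topologicalType := set_type (closure (range x)).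

Lemma X0_subproof n : x n \in closure (range x).
Proof. by rewrite inE; apply: subset_closure; exists n. Qed.

Definition x_in_X0 (n : nat) : X0 := SigSub (X0_subproof n).

Definition X0N : topologicalType := prod_topology (fun _ : nat => X0).

Definition tail (m : nat) : X0N := fun k => x_in_X0 (m + k).

Definition shiftN (w : X0N) : X0N := fun k => w k.+1.

Lemma shiftN_continuous : continuous shiftN.
Proof.
move=> w; apply/cvg_sup; first exact/fmap_filter/nbhs_filter.
move=> k U [_ /= [[W oW <-] Ww] WU]; apply: filterS WU _.
  exact/fmap_filter/nbhs_filter.
have : nbhs (proj k.+1 w) W by exact: open_nbhs_nbhs.
by move=> /(@proj_continuous nat (fun=> X0) k.+1 w).
Qed.

Definition Xx : topologicalType := set_type (closure (range tail)).

Lemma shift_subproof (w : Xx) : shiftN (val w) \in closure (range tail).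
Proof.
rewrite inE => B /shiftN_continuous Bw.
have [_ [[m _ <-] Bm]] := set_valP w _ Bw.
exists (tail m.+1); split; first by exists m.+1.
rewrite (_ : tail m.+1 = shiftN (tail m)) //.
by apply/funext => k; rewrite /shiftN /tail addSnnS.
Qed.

Definition shiftX (w : Xx) : Xx := SigSub (shift_subproof w).

Lemma shiftX_continuous : continuous shiftX.
Proof.
apply: (@continuous_comp_initial Xx Xx X0N val) => w.
apply: (@continuous_comp _ _ _ (val : Xx -> X0N) shiftN).
  exact: (@initial_continuous Xx X0N val).
exact: shiftN_continuous.
Qed.

Definition AE : \bar R := topological_entropy R shiftX.

End anqie_entropy.

Definition times_mod1 (R : realType) (a : nat -> int) (x : R) : nat -> RmodZ R :=
  fun n => mod1 ((a n)%:~R * x).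

Definition is_dual_entropy (R : realType) (a : nat -> int) (l : \bar R) : Prop :=
  (0 <= l)%E /\ {ae @lebesgue_measure R, forall x : R, AE R (times_mod1 a x) = l}.

Definition squarefree (m : nat) : Prop :=
  (0 < m)%N /\ forall d : nat, (d ^ 2 %| m)%N -> d = 1%N.

(* Main.v *)
Require Import Defs.
From mathcomp Require Import all_boot all_order all_algebra.
From mathcomp Require Import generic_quotient zify ring lra.
From mathcomp Require Import all_classical all_reals all_analysis.
Set Implicit Arguments.
Unset Strict Implicit.
Unset Printing Implicit Defensive.
Import Order.TTheory GRing.Theory Num.Theory.
Import numFieldNormedType.Exports.
Local Open Scope nat_scope.

(** The entropy of [a(n) x mod 1] is infinite for every irrational [x].  By the
Chinese remainder theorem and a count of large square divisors, every finite set
of square-free numbers [m < M] is, for infinitely many [N], exactly the set of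
those [m < M] for which [N + m] is square-free.  Applied to the first [K]
square-free numbers this gives infinitely many disjoint translates of them inside
the square-free numbers; applied to a selection of one point from each of the
first [n + 1] translates, it shows that each of the [K ^ n] selections with a given
first point occurs, up to translation, as a block of consecutive terms of [a].
Two selections differ by a nonzero bounded integer [d] at some place, and [d x]
stays away from the integers, so a cover by short arcs separates the
corresponding points of the orbit closure: its [n + 1]-st join needs at least
[K ^ n] elements, and [K] is arbitrary.  The limit defining the entropy of the
cover exists by Fekete's lemma. *)

(** * Patterns in the square-free numbers *)

Lemma squarefree_prime m : 0 < m ->
  (forall p, prime p -> ~~ (p ^ 2 %| m)) -> squarefree m.
Proof.
move=> m0 H; split=> // d dm; apply: contrapT => /eqP d1.
have d0 : 0 < d by case: d dm d1 => //; rewrite exp0n// dvd0n; lia.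
have /pdivP[p pp pd] : 1 < d by lia.
by have /negP := H p pp; apply; apply: dvdn_trans dm; apply: dvdn_exp2r.
Qed.

Lemma prime_seq Y : exists q : nat -> nat,
  [/\ forall i, prime (q i), forall i, Y < q i & injective q].
Proof.
pose next m := s2val (prime_above m).
have nextP m : m < next m /\ prime (next m).
  by rewrite /next; case: prime_above.
pose q i := iter i.+1 next Y.
have qlt : forall i j, i < j -> q i < q j.
  by apply: (homo_ltn ltn_trans) => i; exact: (nextP (q i)).1.
exists q; split=> [i|i|i j qij].
- exact: (nextP _).2.
- elim: i => [|i IH]; first exact: (nextP _).1.
  exact: ltn_trans IH (nextP _).1.
- by apply/eqP; case: ltngtP => // /qlt; lia.
Qed.

Lemma crt_dvd (k : nat) (q r : nat -> nat) :
  (forall i, i < k -> 0 < q i) ->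
  (forall i j, i < j < k -> coprime (q i) (q j)) ->
  exists N, forall i, i < k -> q i %| N + r i.
Proof.
elim: k => [|k IH] q0 qc; first by exists 0.
have [i ik|i j ijk|N HN] := IH; first by apply: q0; lia.
  by apply: qc; lia.
pose P := \prod_(i < k) q i.
have cop : coprime P (q k).
  rewrite coprime_sym; elim/big_ind: (P) => [|x y *|i _]; first exact: coprimen1.
    by rewrite coprimeMr; apply/andP.
  by rewrite coprime_sym qc// ltn_ord/=.
(* The residue [r k * (q k).-1] represents [- r k] modulo [q k] inside [nat]. *)
pose N' := chinese P (q k) N (r k * (q k).-1).
exists N' => i; rewrite ltnS leq_eqVlt => /predU1P[->|ik].
  rewrite /dvdn -modnDml (chinese_modr cop) modnDml addnC -mulnS prednK ?q0//.
  by rewrite modnMl.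
have qP : q i %| P by rewrite /P (bigD1 (Ordinal ik))//= dvdn_mulr.
have E : N' = N %[mod q i].
  by rewrite -(modn_dvdm _ qP) (chinese_modl cop) modn_dvdm.
by rewrite /dvdn -modnDml E modnDml; exact: HN.
Qed.

(** Since [e] is coprime to [P], two solutions [t] differ by a multiple of [e], so a solution is
    determined by [t %/ e]. *)
Lemma card_dvd_progression (T e c P : nat) : 0 < e -> coprime e P ->
  #|[set t : 'I_T | e %| c + t * P]%SET| <= (T %/ e).+1.
Proof.
move=> e0 eP.
rewrite -[X in _ <= X]card_ord -(@card_in_imset _ _
  (fun t : 'I_T => inord (t %/ e) : 'I_(T %/ e).+1)) ?max_card//.
suff H : forall t t' : 'I_T, t <= t' -> e %| c + t * P -> e %| c + t' * P ->
  t %/ e = t' %/ e -> t = t'.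
  move=> t t'; rewrite !inE => ht ht' /(congr1 val)/=.
  have B (u : 'I_T) : u %/ e < (T %/ e).+1.
    by rewrite ltnS leq_div2r// ltnW.
  rewrite !inordK// => E; case: (leqP t t') => [|/ltnW] L; first exact: H.
  by apply/esym; exact: H.
move=> t t' tt' ht ht' E; apply: val_inj => /=.
have : e %| (t' - t) * P.
  by rewrite mulnBl -(subnDl c) dvdn_sub.
rewrite Gauss_dvdl// -(eqn_mod_dvd _ tt') => /eqP tm.
by rewrite (divn_eq t e) (divn_eq t' e) E tm.
Qed.

(** The right-hand side telescopes when summed over [Y]. *)
Lemma divn_square_le (T Y : nat) : 0 < Y ->
  ((T %/ Y.+1 ^ 2)%:R <= T%:R / Y%:R - T%:R / Y.+1%:R :> rat)%R.
Proof.
move=> Y0; rewrite (@le_trans _ _ (T%:R / (Y.+1 ^ 2)%:R)%R)//.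
  by rewrite ler_pdivlMr ?ltr0n ?expn_gt0// -natrM ler_nat leq_divM.
have Y1 : (0 < Y%:R :> rat)%R by rewrite ltr0n.
rewrite -mulrBr ler_wpM2l// natrX -natr1.
rewrite -subr_ge0 (_ : (_ - _ = (Y%:R * (Y%:R + 1) ^+ 2)^-1)%R); last first.
  by field; rewrite !gt_eqF//; lra.
by rewrite invr_ge0 mulr_ge0 ?exprn_ge0//; lra.
Qed.

Lemma sum_div_squares (Y D T : nat) : 0 < Y ->
  \sum_(Y <= d < D) T %/ d.+1 ^ 2 <= T %/ Y.
Proof.
move=> Y0; have [DY|YD] := leqP D Y; first by rewrite big_geq.
rewrite leq_divRL//.
(* The induction needs the sharper bound with [T / D] subtracted, hence exact division in [rat]. *)
suff H : ((\sum_(Y <= d < D) T %/ d.+1 ^ 2)%:R <=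
    T%:R / Y%:R - T%:R / D%:R :> rat)%R.
  rewrite -(@ler_nat rat) natrM -ler_pdivlMr ?ltr0n// (le_trans H)//.
  by rewrite gerBl divr_ge0// ler0n.
elim: D YD => // D IH; rewrite ltnS leq_eqVlt => /predU1P[<-|YD].
  by rewrite big_nat1 divn_square_le.
rewrite big_nat_recr ?(ltnW YD)//= natrD.
rewrite (le_trans (lerD (IH YD) (divn_square_le T (leq_ltn_trans (leq0n Y) YD))))//.
by rewrite addrA subrK.
Qed.

Lemma card_bigcup_leq (I T : finType) (P : pred I) (F : I -> {set T}) :
  #|(\bigcup_(i | P i) F i)%SET| <= \sum_(i | P i) #|F i|.
Proof.
elim/big_rec2: _ => [|i n A _ IH]; first by rewrite cards0.
by rewrite (leq_trans (leq_card_setU _ _))// leq_add2l.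
Qed.

Lemma progression_avoiding_squares (M r P Y : nat) :
  0 < M -> 0 < P -> 4 * M <= Y ->
  exists t, forall m p, m < M -> Y < p -> coprime p P ->
    ~~ (p ^ 2 %| r.+1 + t * P + m).
Proof.
move=> M0 P0 MY.
(* For [t < T = 4 M s] the numbers considered are at most [s ^ 2], and at most
   [M * (T / Y + s) <= T / 2] values of [t] are bad. *)
pose s := r.+1 + M + 4 * M * P; pose T := 4 * M * s.
(* The index [d] stands for the number [d + 1], so [Y <= d] says that this number exceeds [Y]. *)
pose S m d := [set t : 'I_T | d.+1 ^ 2 %| (r.+1 + m) + t * P]%SET.
pose bad := (\bigcup_(m < M) \bigcup_(d < s | (Y <= d) && coprime d.+1 P) S m d)%SET.
have s0 : 0 < s by rewrite /s; lia.
have Scard : #|bad| <= M * (s + s).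
  rewrite (leq_trans (card_bigcup_leq _ _))//.
  rewrite -[X in _ <= X * _]card_ord -sum_nat_const leq_sum// => m _.
  rewrite (leq_trans (card_bigcup_leq _ _))//.
  rewrite (@leq_trans (\sum_(d < s | Y <= d) (T %/ d.+1 ^ 2).+1))//.
    rewrite big_mkcondr/= leq_sum// => d _; case: ifP => // dP.
    by apply: card_dvd_progression; rewrite ?expn_gt0// coprimeXl.
  under eq_bigr do rewrite -addn1.
  rewrite big_split/= leq_add//; last first.
    by rewrite sum1_card (leq_trans (max_card _))// card_ord.
  have [sY|Ys] := leqP s Y.
    by rewrite big1// => d; have := ltn_ord d; lia.
  rewrite -(big_mkord (fun d => Y <= d) (fun d => T %/ d.+1 ^ 2)).
  rewrite (big_cat_nat _ (n := Y))//=; last exact: ltnW.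
  rewrite big1_seq ?add0n => [|d]; last by rewrite mem_index_iota; lia.
  rewrite (@leq_trans (\sum_(Y <= d < s) T %/ d.+1 ^ 2))//.
    by rewrite big_mkcond/= leq_sum// => d _; case: ifP.
  have M4 : 0 < 4 * M by rewrite muln_gt0.
  rewrite (leq_trans (sum_div_squares _ _ (leq_trans M4 MY)))//.
  by rewrite (leq_trans (leq_div2l _ M4 MY))// /T mulKn.
have /card_gt0P[t] : 0 < #|~: bad|.
  have Ms : 0 < M * s by rewrite muln_gt0 M0.
  have := cardsC bad; rewrite card_ord [in RHS]/T -mulnA.
  by move: Scard; rewrite mulnDr; lia.
rewrite inE => tbad; exists t => m p mM Yp pP; apply: contra tbad => dv.
have p0 : 0 < p by lia.
have ps : p.-1 < s.
  (* The successor in [r.+1] keeps the number positive, so its divisors are bounded by it. *)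
  have : p ^ 2 <= s ^ 2.
    apply: leq_trans (dvdn_leq _ dv) _; first by lia.
    have tT : t < 4 * M * s := ltn_ord t.
    have : t * P <= 4 * M * s * P by rewrite leq_mul2r ltnW ?orbT.
    by rewrite /s; nia.
  by rewrite leq_exp2r//; lia.
apply/bigcupP; exists (Ordinal mM) => //.
apply/bigcupP; exists (Ordinal ps); rewrite /= ?inE/= prednK//.
  by rewrite pP andbT; lia.
by rewrite addnAC.
Qed.

Lemma prime_dvd_fact p n : prime p -> p %| n`! -> p <= n.
Proof.
move=> pp; elim: n => [|n IH]; first by rewrite dvdn1 => /eqP p1; rewrite p1 in pp.
rewrite factS Euclid_dvdM// => /orP[/dvdn_leq->//|/IH]; exact: leqW.
Qed.

(** For [m] in [B] every prime [p] falls under one of three cases. If [p <= Y], then [N + m] is [m]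
    modulo [p ^ 2]. If [p > Y] is coprime to [P], the choice of [t] excludes it. Otherwise [p] is
    some [q i] with [i] outside [B]; its square divides [N + i] and is longer than the window, so it
    cannot divide [N + m] too. *)
Lemma squarefree_pattern (M N0 : nat) (B : pred nat) :
  (forall m, m < M -> B m -> squarefree m) ->
  exists N, N0 <= N /\ forall m, m < M -> squarefree (N + m) <-> B m.
Proof.
case: M => [|M] HB; first by exists N0.
pose Y := 4 * M.+1.
have [q [qp qY qI]] := prime_seq Y.
(* Modulo [Y!^2] the shift does not affect small primes; each [i] outside [B] gets
   its own prime [q i], whose square is made to divide [N + i]. *)
pose g i := if i is i'.+1 then (if B i' then 1 else q i') ^ 2 else Y`! ^ 2.
pose rr i := if i is i'.+1 then i' else 0.
have Yq i : coprime (Y`!) (q i).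
  rewrite coprime_sym prime_coprime//; apply/negP => /((prime_dvd_fact (qp i))).
  by have := qY i; lia.
have [i _|i j ijM|N1 HN1] := @crt_dvd M.+2 g rr.
- case: i => [|i]/=; rewrite expn_gt0 ?fact_gt0//.
  by case: ifP => // _; rewrite prime_gt0.
- case: j ijM => // j; case: i => [|i] ij /=; rewrite coprimeXl// coprimeXr//.
    by case: ifP => // _; exact: coprimen1.
  case: ifP => Bi; first exact: coprime1n.
  case: ifP => Bj; first exact: coprimen1.
  rewrite prime_coprime// dvdn_prime2//; apply/eqP => /qI; lia.
pose P := \prod_(i < M.+2) g i.
have g0 i : 0 < g i.
  case: i => [|i] /=; rewrite expn_gt0 ?fact_gt0//.
  by case: ifP => // _; rewrite prime_gt0.
have P0 : 0 < P by rewrite prodn_gt0.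
have gP i : i < M.+2 -> g i %| P.
  by move=> iM; rewrite /P (bigD1 (Ordinal iM))//= dvdn_mulr.
have [t Ht] := @progression_avoiding_squares M.+1 (N1 + N0.+1 * P).-1 P Y
  isT P0 (leqnn _).
rewrite prednK in Ht; last by nia.
(* Multiples of [P] preserve all the congruences; [N0.+1] of them force [N0 <= N]. *)
pose N := N1 + N0.+1 * P + t * P.
have HN i : i < M.+2 -> g i %| N + rr i.
  move=> iM; rewrite (_ : _ + _ = N1 + rr i + (N0.+1 + t) * P); last first.
    by rewrite /N; lia.
  by rewrite dvdn_addr ?HN1// dvdn_mull// gP.
exists N; split=> [|m mM]; first by rewrite /N; nia.
split=> [[_ sq]|Bm].
  apply: contraT => Bm; have := HN m.+1; rewrite /= (negbTE Bm) => /(_ mM)/sq q1.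
  by have := qp m; rewrite q1.
have [m0 sm] := HB _ mM Bm.
apply: squarefree_prime => [|p pp]; first lia.
apply/negP => pd.
have [pY|Yp] := leqP p Y.
  suff /sm p1 : p ^ 2 %| m by rewrite p1 in pp.
  rewrite -(dvdn_addr _ (_ : p ^ 2 %| N))//.
  rewrite -[N]addn0 (dvdn_trans _ (HN 0 _))//= dvdn_exp2r//.
  by rewrite dvdn_fact// prime_gt0.
have [pP|] := boolP (coprime p P); first by have /negP := Ht _ _ mM Yp pP.
rewrite prime_coprime// negbK.
rewrite (Euclid_dvd_prod _ _ _ pp) big_has_cond => /hasP[[i iM] _] /=.
case: i iM => [|i] iM /=; rewrite Euclid_dvdX//= andbT.
  by move=> /(prime_dvd_fact pp); lia.
case: ifP => Bi; first by rewrite dvdn1 => /eqP p1; rewrite p1 in pp.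
rewrite dvdn_prime2// => /eqP pq.
have := HN i.+1 iM; rewrite /= Bi -pq => pi.
have mi : m <> i by move=> mi; rewrite mi Bi in Bm.
have p2 : M.+1 < p ^ 2 by rewrite /Y in Yp; nia.
suff H u v : u < v < M.+1 -> p ^ 2 %| N + u -> p ^ 2 %| N + v -> False.
  by case: (ltngtP m i) => // L; [apply: (H m i)|apply: (H i m)]; rewrite ?L.
move=> uv pu pv; have : p ^ 2 %| v - u by rewrite -(subnDl N) dvdn_sub.
by move=> /dvdn_leq; lia.
Qed.

(** * Blocks of consecutive terms of an enumeration *)

Lemma increasing_ltn (a : nat -> nat) :
  (forall m n, m < n -> a m < a n) -> forall m n, (a m < a n) = (m < n).
Proof.
move=> H m n; case: (ltngtP m n) => [/H//|/H L|->]; last exact: ltnn.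
by apply/negbTE; rewrite -leqNgt ltnW.
Qed.

(** By induction, the term of [a] after [b i] is at most [b i.+1], which is itself a later term of
    [a]. So it lies in the window and is some [b k] with [b i < b k <= b i.+1]. *)
Lemma enumeration_window (S : nat -> Prop) (a b : nat -> nat) (n : nat) :
  (forall m n, m < n -> a m < a n) -> (forall m n, m < n -> b m < b n) ->
  range a = [set m | S m]%classic -> (forall i, i <= n -> S (b i)) ->
  (forall k, b 0 <= k <= b n -> S k -> exists2 i, i <= n & k = b i) ->
  exists m, forall i, i <= n -> a (m + i) = b i.
Proof.
move=> /increasing_ltn aI /increasing_ltn bI aS Sb bS.
have aP k : S k -> exists m, a m = k.
  by move=> Sk; have [m _ <-] : range a k by [rewrite aS]; exists m.
have Sa m : S (a m).
  by have : range a (a m) by [exists m]; rewrite aS.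
have [m am] := aP _ (Sb 0 isT); exists m; elim=> [|i IH] ilt; first by rewrite addn0.
have {}IH := IH (ltnW ilt); have [j aj] := aP _ (Sb _ ilt).
have mij : m + i < j by rewrite -aI aj IH bI.
have up : a (m + i.+1) <= b i.+1 by rewrite -aj leqNgt aI -leqNgt addnS.
have [|k kn ak] := bS (a (m + i.+1)) _ (Sa _).
  rewrite (leq_trans up) ?andbT//; last by rewrite leqNgt bI -leqNgt.
  by rewrite -am ltnW// aI; lia.
apply/eqP; rewrite eqn_leq up/= ak leqNgt bI -leqNgt.
by rewrite -bI -ak -IH aI addnS.
Qed.

(** Here [h i j] is [a j] moved into the [i]-th translate, and [G] bounds the length of every
    translate. The pattern lemma serves twice: to find the translates, and to make the selected
    points the only square-free ones in their window. *)
Lemma squarefree_choice_patterns (a : nat -> nat) (K : nat) :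
  (forall m n, m < n -> a m < a n) -> range a = [set m | squarefree m]%classic ->
  exists G (h : nat -> nat -> nat),
    [/\ forall i, injective (h i),
        forall i j k, j < K -> k < K -> h i j <= h i k + G &
        forall n f, (forall i, f i < K) ->
          exists m N, forall i, i <= n -> a (m + i) = N + h i (f i)].
Proof.
move=> a_incr a_range; have aI := increasing_ltn a_incr.
have sa i : squarefree (a i).
  by have : range a (a i) by [exists i]; rewrite a_range.
have step N0 : exists N, N0 <= N /\ forall j, j < K -> squarefree (N + a j).
  have [N [N0N NP]] := @squarefree_pattern (a K) N0
    (fun m => `[< squarefree m >]) (fun m _ => @asboolW _).
  exists N; split=> // j jK; apply/NP; first by rewrite aI.
  exact/asboolT.
pose next N0 := xget 0
  [set N | N0 <= N /\ forall j, j < K -> squarefree (N + a j)]%classic.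
have nextP N0 : N0 <= next N0 /\ forall j, j < K -> squarefree (next N0 + a j).
  by rewrite /next; have [N HN] := step N0; case: xgetP => [N' _//|/(_ N)].
(* The jump by [a K] places successive translates in disjoint increasing ranges, so every selection
   is increasing. *)
pose s i := iter i (fun N => next (N + a K)) (next 0).
have sS i j : j < K -> squarefree (s i + a j).
  by move=> jK; case: i => [|i]; exact: (nextP _).2.
have sI i : s i + a K <= s i.+1 by exact: (nextP _).1.
exists (a K), (fun i j => s i + a j); split=> [i j k /addnI ajk|i j k jK kK|n f fK].
- by apply/eqP; case: ltngtP => // /a_incr; rewrite ajk ltnn.
- by rewrite -addnA leq_add2l (leq_trans _ (leq_addl _ _))// ltnW// aI.
pose b i := s i + a (f i).
have bI i j : i < j -> b i < b j.
  apply: (homo_ltn ltn_trans) => {}i.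
  apply: leq_trans (leq_trans (sI i) (leq_addr _ _)).
  by rewrite ltn_add2l aI.
pose B m := has (fun i => m == b i) (iota 0 n.+1).
have [|N [_ NP]] := @squarefree_pattern (b n).+1 0 B.
  by move=> m _ /hasP[i _ /eqP ->]; exact: sS.
have NB i : i <= n -> squarefree (N + b i).
  move=> ilt; apply/NP; last by apply/hasP; exists i; rewrite ?mem_iota.
  by rewrite ltnS leqNgt (increasing_ltn bI) -leqNgt.
have [|k bk Sk|m Hm] := enumeration_window a_incr
  (_ : forall m n, m < n -> N + b m < N + b n) a_range NB.
- by move=> u v uv; rewrite ltn_add2l bI.
- have E : k = N + (k - N) by lia.
  move: Sk; rewrite E NP; last lia.
  by case/hasP => i; rewrite mem_iota/= => ilt /eqP ->; exists i.
by exists m, N.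
Qed.

Local Open Scope classical_set_scope.
Local Open Scope ring_scope.

(** * Entropy of finite covers *)

Section Fekete.
Variables (R : realType) (u : nat -> R).
Hypothesis u_ge0 : forall n, 0 <= u n.
Hypothesis u_subadd : forall m n, u (m + n)%N <= u m + u n.

Lemma subadditive_mull q m : u (q * m)%N <= q%:R * u m + u 0%N.
Proof.
elim: q => [|q IH]; first by rewrite mul0n mul0r add0r.
by rewrite mulSn (le_trans (u_subadd _ _))// mulrSr; lra.
Qed.

(** The limit is the infimum of the quotients over positive indices. Divide [n] by an [m] whose
    quotient is within [e / 2] of it; the remainder costs at most a constant [C]. *)
Lemma subadditive_cvg : cvgn (fun n => n%:R^-1 * u n).
Proof.
pose A := [set n%:R^-1 * u n | n in [set n | (0 < n)%N]].
have A0 : has_inf A.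
  split; first by exists (1%:R^-1 * u 1%N), 1%N.
  by exists 0 => _ [n _ <-]; rewrite mulr_ge0// invr_ge0.
apply/cvg_ex; exists (inf A); apply/cvgrPdist_lt => e e0.
have [_ [m /= m0 <-] me] := inf_adherent (divr_gt0 e0 (ltr0Sn R 1)) A0.
pose C := u 0%N + \sum_(r < m) u r.
have uC n : u n <= (n %/ m)%:R * u m + C.
  rewrite {1}(divn_eq n m) (le_trans (u_subadd _ _))//.
  have := subadditive_mull (n %/ m) m.
  suff : u (n %% m)%N <= \sum_(r < m) u r by rewrite /C; lra.
  rewrite (bigD1 (Ordinal (ltn_pmod n m0)))//= lerDl sumr_ge0//.
have C0 : 0 <= C by rewrite addr_ge0// sumr_ge0.
(* From this index on, [C / n] is below the other [e / 2]. *)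
exists (Num.bound (2 * C / e)).+1 => // n /= nlarge.
have n0 : (0 < n)%N by exact: leq_trans nlarge.
have lo : inf A <= n%:R^-1 * u n.
  by apply: ge_inf; [exact: A0.2|exists n].
have hi : n%:R^-1 * u n < inf A + e.
  have n0R : 0 < n%:R :> R by rewrite ltr0n.
  have m0R : 0 < m%:R :> R by rewrite ltr0n.
  have Cn : 2 * C < e * n%:R.
    rewrite [ltRHS]mulrC -ltr_pdivrMr//.
    have /lt_le_trans : 2 * C / e < (Num.bound (2 * C / e))%:R.
      by apply: archi_boundP; rewrite divr_ge0 ?mulr_ge0// ltW.
    by apply; rewrite ler_nat ltnW.
  have qm : (n %/ m)%:R * m%:R <= n%:R :> R by rewrite -natrM ler_nat leq_divM.
  have um : u m < (inf A + e / 2) * m%:R by rewrite -ltr_pdivrMr// mulrC.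
  have L0 : 0 <= inf A.
    apply: lb_le_inf; first exact: A0.1.
    by move=> _ [k _ <-]; rewrite mulr_ge0// invr_ge0.
  rewrite mulrC ltr_pdivrMr//.
  rewrite (le_lt_trans (uC n))//.
  have : (n %/ m)%:R * u m <= (inf A + e / 2) * n%:R.
    rewrite (@le_trans _ _ ((n %/ m)%:R * ((inf A + e / 2) * m%:R)))//.
      by rewrite ler_wpM2l// ltW.
    by rewrite mulrCA ler_wpM2l//; lra.
  by lra.
by rewrite distrC ger0_norm; lra.
Qed.

End Fekete.

Section subcovers.
Variables (R : realType) (X : topologicalType) (T : X -> X) (U : set (set X)).

Lemma bigcover_joinE (F : nat -> set (set X)) n :
  \big[@cover_join X/[set setT]]_(i < n) F i =
  [set W | exists2 g : nat -> set X, forall i, (i < n)%N -> F i (g i) &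
    W = [set w | forall i, (i < n)%N -> g i w]].
Proof.
elim: n F => [|n IH] F.
  rewrite big_ord0; apply/seteqP; split=> W /=.
    by move=> ->; exists (fun=> set0) => //; apply/seteqP; split.
  by case=> g _ ->; apply/seteqP; split.
rewrite big_ord_recl (IH (fun i => F i.+1)); apply/seteqP; split=> W /=.
  case=> A FA [_ [g Fg ->] <-].
  exists (fun i => if i is i'.+1 then g i' else A) => [[|i]//|].
  - exact: Fg.
  - apply/seteqP; split=> w /=.
      by case=> Aw gw [|i]// iltn; exact: gw.
    by move=> H; split; [exact: (H 0%N)|move=> i iltn; exact: (H i.+1)].
case=> g Fg ->; exists (g 0%N); first exact: Fg.
exists [set w | forall i, (i < n)%N -> g i.+1 w].
  by exists (fun i => g i.+1) => // i iltn; exact: Fg.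
apply/seteqP; split=> w /=.
  by case=> Aw gw [|i]// iltn; exact: gw.
by move=> H; split; [exact: (H 0%N)|move=> i iltn; exact: (H i.+1)].
Qed.

(** Elements of the join are itineraries: [g i] is the member of [U] visited at time [i], and only
    times below [n] count. *)
Lemma iterated_joinP n W : iterated_join T U n W <->
  exists2 g : nat -> set X, forall i, (i < n)%N -> U (g i) &
    W = [set w | forall i, (i < n)%N -> g i (iter i T w)].
Proof.
rewrite /iterated_join (bigcover_joinE (fun i => preimage_cover (iter i T) U)).
split=> [[g Fg ->]|[g Ug ->]]; last first.
  by exists (fun i => iter i T @^-1` g i) => // i iltn; exists (g i) => //; exact: Ug.
have /choice[h Hh] i : exists A, (i < n)%N -> U A /\ iter i T @^-1` A = g i.
  have [iltn|_] := boolP (i < n)%N; last by exists set0.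
  by have [A UA AE] := Fg i iltn; exists A.
exists h => [i /Hh[]//|]; apply/seteqP; split=> w /= H i iltn.
  by have := H i iltn; rewrite -(Hh i iltn).2.
by rewrite -(Hh i iltn).2; exact: H.
Qed.

Definition has_subcover n k :=
  exists V, [/\ V `<=` iterated_join T U n, (V #= `I_k)%card & covers V].

(** The family [f] may repeat sets while [has_subcover] records an exact cardinality, hence
    [l <= k]. *)
Lemma has_subcoverP n k (f : nat -> set X) :
  (forall i, (i < k)%N -> iterated_join T U n (f i)) ->
  (forall w, exists2 i, (i < k)%N & f i w) ->
  exists2 l, (l <= k)%N & has_subcover n l.
Proof.
move=> Jf fc; have /finite_setP[l Vl] : finite_set (f @` `I_k).
  exact/finite_image/finite_II.
exists l.
  by rewrite -card_le_II -(card_le_eql Vl) card_image_le.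
exists (f @` `I_k); split=> //; first by move=> _ [i ik <-]; exact: Jf.
apply/seteqP; split=> // w _; have [i ik fw] := fc w.
by exists (f i) => //; exists i.
Qed.

Lemma has_subcover_enum n k : has_subcover n k -> exists f : nat -> set X,
  (forall i, (i < k)%N -> iterated_join T U n (f i)) /\
  (forall w, exists2 i, (i < k)%N & f i w).
Proof.
move=> [V [VJ /card_esym/card_set_bijP[f [fV _ fS]] Vc]]; exists f; split=> [i ik|w].
  exact/VJ/fV.
have : setT w by []. rewrite -Vc => -[A VA Aw].
by have [i ik fi] := fS A VA; exists i => //; rewrite fi.
Qed.

(** Itineraries concatenate, the second being read after [m] steps; this makes the logarithms of the
    subcover numbers subadditive. The pair [(i, j)] is coded as [i * l + j]. *)
Lemma has_subcover_add m n k l : has_subcover m k -> has_subcover n l ->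
  exists2 j, (j <= k * l)%N & has_subcover (m + n) j.
Proof.
move=> /has_subcover_enum[f [fJ fc]] /has_subcover_enum[g [gJ gc]].
apply: (@has_subcoverP _ _ (fun t => f (t %/ l)%N `&` iter m T @^-1` g (t %% l)%N)).
  move=> t tkl; have l0 : (0 < l)%N by case: l tkl {gJ gc} => //; rewrite muln0.
  have /iterated_joinP[f' Uf ->] := fJ (t %/ l)%N (ltac:(by rewrite ltn_divLR)).
  have /iterated_joinP[g' Ug ->] := gJ (t %% l)%N (ltn_pmod _ l0).
  apply/iterated_joinP; exists (fun i => if (i < m)%N then f' i else g' (i - m)%N).
    by move=> i imn; case: ifP => [/Uf//|im]; apply: Ug; lia.
  apply/seteqP; split=> w /=.
    case=> fw gw i imn; case: ifPn => [/fw//|]; rewrite -leqNgt => mi.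
    have := gw (i - m)%N; rewrite -iterD subnK//; apply; lia.
  move=> H; split=> i iltn; first by have := H i; rewrite iltn; apply; lia.
  have /H : (i + m < m + n)%N by lia.
  by rewrite ifN ?addnK ?iterD// -leqNgt leq_addl.
move=> w; have [i ik fw] := fc w; have [j jl gw] := gc (iter m T w).
have l0 : (0 < l)%N by exact: leq_ltn_trans jl.
exists (i * l + j)%N; first by nia.
by rewrite divnMDl// divn_small// addn0 modnMDl modn_small.
Qed.

(** This takes the place of compactness: by concatenation every join then has a finite subcover. *)
Hypothesis U_finite : exists k, has_subcover 1 k.

Lemma has_subcover_ex n : exists k, has_subcover n k.
Proof.
elim: n => [|n [k nk]].
  exists 1%N, [set setT]; split.
  - by rewrite /iterated_join big_ord0.
  - by rewrite card_set1.
  - by rewrite /covers bigcup_set1.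
have [l l1] := U_finite; rewrite -addn1.
by have [j _] := has_subcover_add nk l1; exists j.
Qed.

Fact has_subcover_exb n : exists k, `[< has_subcover n k >].
Proof. by have [k nk] := has_subcover_ex n; exists k; apply/asboolP. Qed.

Definition subcover_number n := ex_minn (has_subcover_exb n).

Lemma subcover_numberP n : has_subcover n (subcover_number n) /\
  forall k, has_subcover n k -> (subcover_number n <= k)%N.
Proof.
rewrite /subcover_number; case: ex_minnP => k /asboolP nk kmin; split=> // l nl.
exact/kmin/asboolP.
Qed.

Lemma min_subcoverE n :
  min_subcover R (iterated_join T U n) = (subcover_number n)%:R%:E.
Proof.
have [nk kmin] := subcover_numberP n.
apply/eqP; rewrite eq_le; apply/andP; split.
  by apply: ereal_inf_lbound; exists (subcover_number n).
apply: le_ereal_inf_tmp => _ [k /= /kmin kl <-].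
by rewrite lee_fin ler_nat.
Qed.

(** The point [w0] makes the subcover numbers positive, so their logarithms are real and nonnegative
    and Fekete's lemma applies. *)
Lemma cover_entropy_ge (w0 : X) (K : nat) : (0 < K)%N ->
  (forall n k, has_subcover n.+1 k -> (K ^ n <= k)%N) ->
  ((ln (K%:R : R) / 2)%:E <= cover_entropy R T U)%E.
Proof.
move=> K0 HK.
have N0 n : (0 < subcover_number n)%N.
  have [/has_subcover_enum[f [_ /(_ w0)[i ik _]]] _] := subcover_numberP n.
  exact: leq_ltn_trans ik.
have N0R n : 0 < (subcover_number n)%:R :> R by rewrite ltr0n.
pose u n := ln ((subcover_number n)%:R : R).
have u_cvg : cvgn (fun n => n%:R^-1 * u n).
  apply: subadditive_cvg => [n|m n].
    by rewrite ln_ge0// ler1n.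
  rewrite /u -lnM ?posrE// -natrM ler_ln ?posrE ?ltr0n ?muln_gt0 ?N0// ler_nat.
  have [j jkl] := has_subcover_add (subcover_numberP m).1 (subcover_numberP n).1.
  by move=> /(subcover_numberP _).2/leq_trans; apply.
rewrite /cover_entropy.
rewrite (_ : (fun n => _) = EFin \o (fun n => n%:R^-1 * u n)); last first.
  by apply/funext => n /=; rewrite min_subcoverE lne_EFin// EFinM.
rewrite EFin_lim// lee_fin; apply: limr_ge => //.
(* The factor [1 / 2] comes from [n / (n + 1) >= 1 / 2] for [n >= 1]. *)
exists 2%N => // -[//|n] /= n1.
have uK : n%:R * ln (K%:R : R) <= u n.+1.
  rewrite mulrC mulr_natr -lnXn ?ltr0n// -natrX.
  rewrite ler_ln ?posrE ?ltr0n ?expn_gt0 ?K0 ?N0//.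
  by rewrite ler_nat HK//; exact: (subcover_numberP _).1.
have K1 : 0 <= ln (K%:R : R) by rewrite ln_ge0// ler1n.
rewrite [leRHS]mulrC ler_pdivlMr//.
have : 0 <= ln (K%:R : R) * (n%:R - 1) by rewrite mulr_ge0// subr_ge0 ler1n.
by rewrite -(natr1 n); lra.
Qed.

End subcovers.

(** * Irrational rotations *)

Section circle.
Variable R : realType.
Implicit Types r s c e x : R.

Lemma mod1_eqP r s : mod1 r = mod1 s <-> r - s \is a Num.int.
Proof. by split=> [/eqquotP|rs]//; exact/eqquotP. Qed.

Definition arc c e : set (RmodZ R) := @mod1 R @` ball c e.

Lemma arc_open c e : open (arc c e).
Proof.
(* In the quotient topology, openness means openness of the preimage, here a union of integer
   translates of a ball. *)
suff H : open (@mod1 R @^-1` arc c e) by exact: H.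
rewrite (_ : _ @^-1` _ = \bigcup_(k : int) ball (c + k%:~R) e).
  by apply: bigcup_open => k _; exact: ball_open.
apply/seteqP; split=> [r [s cs /mod1_eqP /intrP[k srk]]|r [k _ ckr]].
  exists (- k) => //; move: cs; rewrite /ball/= rmorphN/= -srk.
  by rewrite (_ : c - s = c + - (s - r) - r); last ring.
exists (r - k%:~R).
  move: ckr; rewrite /ball/=.
  by rewrite (_ : c + k%:~R - r = c - (r - k%:~R)); last ring.
by apply/mod1_eqP; rewrite addrAC subrr add0r rpredN intr_int.
Qed.

Lemma arc_dist c e r s : arc c e (mod1 r) -> arc c e (mod1 s) ->
  exists k : int, `|r - s - k%:~R| < 2 * e.
Proof.
move=> [r' cr /mod1_eqP/intrP[k rk]] [s' cs /mod1_eqP/intrP[l sl]].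
exists (l - k); rewrite rmorphB/= -rk -sl.
rewrite (_ : _ - _ = (c - s') - (c - r')); last ring.
by rewrite (le_lt_trans (ler_normB _ _))//; move: cr cs; rewrite /ball/=; lra.
Qed.

Lemma arc_cover (q : nat) (y : RmodZ R) : (0 < q)%N ->
  exists2 i, (i < q)%N & arc (i%:R / q%:R) q%:R^-1 y.
Proof.
move=> q0; have q0R : 0 < q%:R :> R by rewrite ltr0n.
have [r ->] : exists r, y = mod1 r by exists (repr y); rewrite /mod1 reprK.
pose t := r - (Num.floor r)%:~R.
have t0 : 0 <= t by rewrite subr_ge0 floor_le.
have t1 : t < 1 by have := floorD1_gt r; rewrite rmorphD rmorph1 -ltrBlDl.
have := @truncn_itv R (t * q%:R) (mulr_ge0 t0 (ltW q0R)).
set j := Num.truncn _ => /andP[j1 j2]; exists j.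
  by rewrite -(ltr_nat R) (le_lt_trans j1)// gtr_pMl.
exists t; last by apply/mod1_eqP; rewrite /t addrAC subrr add0r rpredN intr_int.
rewrite /ball/= distrC ger0_norm.
  by rewrite ltrBlDl -{2}(mul1r q%:R^-1) -mulrDl ltr_pdivlMr// natr1.
by rewrite subr_ge0 ler_pdivrMr.
Qed.

Lemma irrational_dist_int x : irrational x -> forall d, (0 < d)%N ->
  exists2 e : R, 0 < e & forall k : int, e <= `|d%:R * x - k%:~R|.
Proof.
move=> xirr d d0; set y := d%:R * x; set f := Num.floor y.
have fy : f%:~R < y.
  rewrite lt_neqAle floor_le andbT; apply/eqP => yf; apply: xirr => /=.
  exists (f%:~R / d%:R) => //; rewrite fmorph_div/= ratr_int ratr_nat yf /y.
  by rewrite mulrAC divff ?mul1r// pnatr_eq0 -lt0n.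
have yf : y < (f + 1)%:~R := floorD1_gt y.
(* The nearest integers are [f] and [f + 1]; irrationality makes the first distance positive. *)
exists (Num.min (y - f%:~R) ((f + 1)%:~R - y)).
  by rewrite lt_min !subr_gt0 fy.
move=> k; have [kf|fk] := leP k f.
  rewrite ge_min; apply/orP; left; rewrite (le_trans _ (ler_norm _))//.
  by rewrite lerD2l lerN2 ler_int.
rewrite ge_min; apply/orP; right; rewrite distrC (le_trans _ (ler_norm _))//.
by rewrite lerD2r ler_int; lia.
Qed.

(** Up to sign only the differences from [1] to [G] occur, so [e] is a minimum of finitely many
    positive distances. *)
Lemma irrational_separated x (G : nat) : irrational x ->
  exists2 e : R, 0 < e & forall (u v : nat) (k : int),
    u <> v -> (u <= v + G)%N -> (v <= u + G)%N ->
    e <= `|(u%:R - v%:R) * x - k%:~R|.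
Proof.
move=> xirr.
have [e e0 He] : exists2 e : R, 0 < e & forall d (k : int),
    (0 < d <= G)%N -> e <= `|d%:R * x - k%:~R|.
  elim: G => [|G [e e0 He]]; first by exists 1 => // d k; lia.
  have [e' e'0 He'] := irrational_dist_int xirr (ltn0Sn G).
  exists (Num.min e e'); first by rewrite lt_min e0.
  move=> d k /andP[d0]; rewrite leq_eqVlt => /predU1P[->|dG].
    by rewrite ge_min He' orbT.
  by rewrite ge_min He// d0.
exists e => // u v k uv; wlog ltuv : u v k uv / (v < u)%N => [H uG vG|uG _].
  case: (ltngtP u v) => // ?; last exact: H.
  suff -> : (u%:R - v%:R) * x - k%:~R = - ((v%:R - u%:R) * x - (- k)%:~R).
    by rewrite normrN; apply: H => //; exact: nesym.
  by rewrite rmorphN/=; ring.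
by rewrite -natrB ?(ltnW ltuv)// He//; lia.
Qed.

End circle.

(** * Arc covers of the orbit closure *)

Section orbit_closure.
Variables (R : realType) (x : nat -> RmodZ R).
Local Notation X := (Xx x).

Definition orbit_point (m : nat) : X :=
  SigSub (mem_set (subset_closure (ex_intro2 _ _ m I erefl)) :
    tail x m \in closure (range (tail x))).

Definition coord (i : nat) (w : X) : RmodZ R := val (val w i).

Lemma coord_orbit_point m i : coord i (orbit_point m) = x (m + i)%N.
Proof. by []. Qed.

Lemma coord_iter_shift i (w : X) : coord 0 (iter i (@shiftX _ x) w) = coord i w.
Proof.
suff H j : coord j (iter i (@shiftX _ x) w) = coord (i + j) w by rewrite H addn0.
elim: i j => // i IH j; by rewrite addSnnS -IH.
Qed.

Lemma coord0_continuous : continuous (coord 0).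
Proof.
move=> w; apply: (@continuous_comp _ _ _ (fun w : X => val w 0%N) val).
  apply: (@continuous_comp _ _ _ (val : X -> X0N x) (@proj nat (fun=> X0 x) 0%N)).
    exact: (@initial_continuous X (X0N x) val).
  exact: proj_continuous.
exact: (@initial_continuous (X0 x) (RmodZ R) val).
Qed.

Definition arc_cylinders (q : nat) : set (set X) :=
  [set coord 0 @^-1` arc (i%:R / q%:R) q%:R^-1 | i in `I_q].

Lemma arc_cylinders_open_cover q : (0 < q)%N -> open_cover (arc_cylinders q).
Proof.
move=> q0; split=> [_ [i _ <-]|].
  apply: open_comp; last exact: arc_open.
  by move=> w _; exact: coord0_continuous.
apply/seteqP; split=> // w _; have [i iq wi] := arc_cover (coord 0 w) q0.
by exists (coord 0 @^-1` arc (i%:R / q%:R) q%:R^-1) => //; exists i.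
Qed.

(** The [q] arcs already cover the circle; this supplies [U_finite]. *)
Lemma arc_cylinders_finite q : (0 < q)%N ->
  exists k, has_subcover (@shiftX _ x) (arc_cylinders q) 1 k.
Proof.
move=> q0.
have [||k _ Hk] := @has_subcoverP X (@shiftX _ x) (arc_cylinders q) 1 q
   (fun i => coord 0 @^-1` arc (i%:R / q%:R) q%:R^-1); last by exists k.
- move=> i iq; apply/iterated_joinP.
  exists (fun=> coord 0 @^-1` arc (i%:R / q%:R) q%:R^-1); first by exists i.
  by apply/seteqP; split=> w /= => [? [|//]//|H]; exact: (H 0%N).
- by move=> w; exact: arc_cover.
Qed.

Lemma AE_ge (q K : nat) : (0 < q)%N -> (0 < K)%N ->
  (forall n k, has_subcover (@shiftX _ x) (arc_cylinders q) n.+1 k ->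
    (K ^ n <= k)%N) ->
  ((ln (K%:R : R) / 2)%:E <= AE R x)%E.
Proof.
move=> q0 K0 HK; apply: le_trans (ereal_sup_ubound _); last first.
  by exists (arc_cylinders q); first exact: arc_cylinders_open_cover.
exact: (cover_entropy_ge R (arc_cylinders_finite q0) (orbit_point 0) K0 HK).
Qed.

End orbit_closure.

Lemma choice_patterns_AE_ge (R : realType) (a : nat -> nat) (x : R) (K G : nat)
    (h : nat -> nat -> nat) :
  irrational x -> (0 < K)%N -> (forall i, injective (h i)) ->
  (forall i j k, (j < K)%N -> (k < K)%N -> (h i j <= h i k + G)%N) ->
  (forall n f, (forall i, f i < K)%N ->
     exists m N, forall i, (i <= n)%N -> a (m + i)%N = (N + h i (f i))%N) ->
  ((ln (K%:R : R) / 2)%:E <= AE R (times_mod1 (fun n => (a n)%:Z) x))%E.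
Proof.
move=> xirr K0 hI hG hP.
have [e e0 He] := irrational_separated G xirr.
(* Points of one arc are within [2 / q] modulo [1], and two such comparisons are combined below. *)
pose q := (Num.bound (4 / e)).+1.
have q0R : 0 < q%:R :> R by rewrite ltr0n.
have qe : 4 * q%:R^-1 < e.
  rewrite ltr_pdivrMr// mulrC -ltr_pdivrMr//.
  have /lt_le_trans : 4 / e < (Num.bound (4 / e))%:R.
    by apply: archi_boundP; rewrite divr_ge0// ltW.
  by apply; rewrite ler_nat.
apply: (@AE_ge _ _ q) => // n k /has_subcover_enum[g [gJ gc]].
(* The first choice is frozen, so that the unknown translations of two patterns
   can be compared at their first points. *)
pose F (f : {ffun 'I_n -> 'I_K}) i : nat :=
  if i is i'.+1 then if insub i' is Some j then f j else 0%N else 0%N.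
have FK f i : (F f i < K)%N.
  by case: i => //= i; case: insub.
have /choice[m mP] f : exists m, exists N, forall i, (i <= n)%N ->
    a (m + i)%N = (N + h i (F f i))%N.
  exact: hP (FK f).
have /choice[t tP] f : exists t : 'I_k, g t (orbit_point _ (m f)).
  by have [t tk gt] := gc (orbit_point _ (m f)); exists (Ordinal tk).
(* The [K ^ n] choices are compared with the [k] cells by showing that [t] is injective. *)
rewrite -[k]card_ord -[n]card_ord -[K]card_ord -card_ffun.
apply: (@leq_card _ _ t) => f1 f2 t12.
have /iterated_joinP[A AU AE] := gJ _ (ltn_ord (t f1)).
have close i : (i <= n)%N -> exists l : int,
    `|(a (m f1 + i)%N)%:R * x - (a (m f2 + i)%N)%:R * x - l%:~R| < 2 * q%:R^-1.
  move=> ilt; have [c _ cA] := AU i ilt.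
  have := tP f2; have := tP f1; rewrite -t12 AE /= => /(_ i ilt) + /(_ i ilt).
  rewrite -cA /= !coord_iter_shift !coord_orbit_point.
  exact: arc_dist.
have [N1 H1] := mP f1; have [N2 H2] := mP f2.
apply/ffunP => i; apply/val_inj; apply: contrapT => fi.
(* Subtracting the estimate at place [0] cancels [N1 - N2], leaving
   [(h i.+1 (f1 i) - h i.+1 (f2 i)) * x] within [4 / q < e] of [l1 - l0]. *)
have [l0] := close 0%N isT; have [l1] := close i.+1 (ltn_ord i).
have Fi f : F f i.+1 = f i by rewrite /F valK.
rewrite !H1// !H2// !natrD !Fi => h1 h0.
have := He (h i.+1 (f1 i)) (h i.+1 (f2 i)) (l1 - l0) _ (hG _ _ _ _ _) (hG _ _ _ _ _).
move=> /(_ (contra_not (@hI _ _ _) fi)).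
move=> /(_ (ltn_ord _) (ltn_ord _) (ltn_ord _) (ltn_ord _)).
rewrite leNgt => /negP; apply; rewrite rmorphB/=.
move: h1 h0; rewrite /F !ltr_norml; lra.
Qed.

Theorem theorem6p7 (R : realType) (a : nat -> nat)
    (a_incr : forall m n : nat, (m < n)%N -> (a m < a n)%N)
    (a_range : range a = [set m | squarefree m]) :
  is_dual_entropy (fun n => (a n)%:Z) (+oo%E : \bar R).
Proof.
have Qcount : countable (@rational R).
  by apply: (card_le_trans (card_image_le _ _)); exact: countableP.
(* The exceptional points lie among the rationals, a countable and hence null set. *)
split=> //; exists rational; split=> [||x /= AEx].
- by apply: countable_measurable => // t; exact: measurable_set1.
- exact: countable_lebesgue_measure0.
apply: contrapT => xirr; apply: AEx.
apply/eqyP => A A0.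
(* This size makes [ln K / 2] at least [A]. *)
pose K := (Num.bound (expR (2 * A))).
have K0 : expR (2 * A) < K%:R by rewrite archi_boundP// expR_ge0.
have K1 : 0 < K%:R :> R by rewrite (lt_trans _ K0)// expR_gt0.
have [G [h [hI hG hP]]] := squarefree_choice_patterns K a_incr a_range.
apply: le_trans (choice_patterns_AE_ge xirr _ hI hG hP); last by rewrite -(ltr0n R).
rewrite lee_fin ler_pdivlMr// mulrC -ler_expR lnK ?posrE//; exact: ltW.
Qed.
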